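(* Let $F$ be a field and let $A$ be a finite-dimensional $F$-algebra. For every $a, a' \in A$ we have $$\det_A(aa') = \det_A(a)\,\det_A(a').$$
   Context: An $F$-algebra is an associative (not necessarily commutative) ring $A$ with multiplicative identity $1 \neq 0$ which is an $F$-vector space with $\alpha(ab) = (\alpha a)b = a(\alpha b)$ for all $\alpha \in F$, $a,b\in A$. Characteristic polynomial: let $a_1,\dots,a_m$ be an $F$-basis of $A$, $R = F[t_1,\dots,t_m]$ a polynomial ring in commuting indeterminates, $K$ the fraction field of $R$, and $\gamma = \sum_i t_i a_i \in A\otimes_F K$ (the generic element). Let $\mathrm{min.poly.}_{\gamma/K} \in K[x]$ be the monic polynomial of least degree satisfied by $\gamma$; it is a fact that its coefficients lie in $R$. For $a = \sum_i \alpha_i a_i \in A$ with $\alpha_i\in F$, the characteristic polynomial $\mathrm{ch.poly.}_{a,A/F}\in F[x]$ is the image of $\mathrm{min.poly.}_{\gamma/K}$ under the substitution $t_i\mapsto \alpha_i$. It does not depend on the choice of basis, and it is monic of degree $n := \deg \mathrm{min.poly.}_{\gamma/K}$ for every $a$. Write $$\mathrm{ch.poly.}_a(x) = x^n - c_1(a)x^{n-1} + \cdots + (-1)^{n-1}c_{n-1}(a)x + (-1)^n c_n(a).$$ The determinant of $a$ is $\det_A(a) := c_n(a) \in F$. *)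

(* Defs.v *)
From HB Require Import structures.
From Stdlib Require Import ClassicalEpsilon.
From mathcomp Require Import all_boot all_order all_algebra all_field.
From mathcomp.multinomials Require Import mpoly.

Set Implicit Arguments.
Unset Strict Implicit.
Unset Printing Implicit Defensive.

Import GRing.Theory.
Local Open Scope ring_scope.

(* A \otimes_F K for a field morphism iota : F -> K.  A row vector u stands   *)
(* for \sum_i b_i \otimes u_i, where (b_i) is the F-basis vbasis {:A} of A.   *)
Definition scalar_ext (F K : fieldType) (iota : {rmorphism F -> K})
  (A : falgType F) : Type := 'rV[K]_(\dim {:A}).

HB.instance Definition _ (F K : fieldType) (iota : {rmorphism F -> K})
    (A : falgType F) :=
  Vector.copy (scalar_ext iota A) 'rV[K]_(\dim {:A}).

Section ScalarExt.

Context (F K : fieldType) (iota : {rmorphism F -> K}) (A : falgType F).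

Local Notation AK := (scalar_ext iota A).
Local Notation b := (vbasis {:A}).

(* a |-> a \otimes 1 *)
Definition to_ext (a : A) : AK := \row_k iota (coord b k a).

Definition ext_one : AK := to_ext 1.

Definition ext_mul (u v : AK) : AK :=
  \sum_i \sum_j (u 0 i * v 0 j) *: to_ext (b`_i * b`_j).

Lemma to_extD : {morph to_ext : x y / x + y}.
Proof. by move=> x y; apply/rowP=> k; rewrite !mxE linearD rmorphD. Qed.

Lemma to_extZ c x : to_ext (c *: x) = iota c *: to_ext x.
Proof. by apply/rowP=> k; rewrite !mxE linearZ /= rmorphM. Qed.

Lemma to_ext0 : to_ext 0 = 0.
Proof. by apply/rowP=> k; rewrite !mxE linear0 rmorph0. Qed.

Lemma to_ext_sum I (r : seq I) (P : pred I) (f : I -> A) :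
  to_ext (\sum_(i <- r | P i) f i) = \sum_(i <- r | P i) to_ext (f i).
Proof. exact: (big_morph to_ext to_extD to_ext0). Qed.

Lemma to_ext_coord x : x = \sum_i coord b i x *: b`_i.
Proof. by rewrite -coord_vbasis // memvf. Qed.

Lemma to_ext_inj : injective to_ext.
Proof.
move=> x y /rowP exy; rewrite (to_ext_coord x) (to_ext_coord y).
apply: eq_bigr => i _; congr (_ *: _).
by have := exy i; rewrite !mxE => /fmorph_inj.
Qed.

Lemma ext_basis (u : AK) : u = \sum_i u 0 i *: to_ext b`_i.
Proof.
apply/rowP=> k; rewrite summxE (bigD1 k) //= big1 => [|i ik];
  rewrite !mxE coord_free ?(basis_free (vbasisP _)) //.
  by rewrite eqxx rmorph1 mulr1 addr0.
have -> : (i == k) = false by exact: negPf ik.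
by rewrite rmorph0 mulr0.
Qed.

Lemma ext_mulDl : left_distributive ext_mul +%R.
Proof.
move=> u v w; rewrite /ext_mul -big_split; apply: eq_bigr => i _ /=.
rewrite -big_split; apply: eq_bigr => j _ /=.
by rewrite !mxE mulrDl scalerDl.
Qed.

Lemma ext_mulDr : right_distributive ext_mul +%R.
Proof.
move=> u v w; rewrite /ext_mul -big_split; apply: eq_bigr => i _ /=.
rewrite -big_split; apply: eq_bigr => j _ /=.
by rewrite !mxE mulrDr scalerDl.
Qed.

Lemma ext_mulZl k u v : k *: ext_mul u v = ext_mul (k *: u) v.
Proof.
rewrite /ext_mul scaler_sumr; apply: eq_bigr => i _ /=.
rewrite scaler_sumr; apply: eq_bigr => j _ /=.
by rewrite !mxE scalerA mulrA.
Qed.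

Lemma ext_mulZr k u v : k *: ext_mul u v = ext_mul u (k *: v).
Proof.
rewrite /ext_mul scaler_sumr; apply: eq_bigr => i _ /=.
rewrite scaler_sumr; apply: eq_bigr => j _ /=.
by rewrite !mxE scalerA mulrCA.
Qed.

Lemma to_extM x y : to_ext (x * y) = ext_mul (to_ext x) (to_ext y).
Proof.
rewrite {1}(to_ext_coord x) mulr_suml to_ext_sum; apply: eq_bigr => i _.
rewrite {1}(to_ext_coord y) mulr_sumr to_ext_sum; apply: eq_bigr => j _.
by rewrite -scalerAl -scalerAr !to_extZ scalerA !mxE.
Qed.

Lemma eq_ext_linear (f g : AK -> AK) :
  {morph f : x y / x + y} -> (forall k, {morph f : x / k *: x}) ->
  {morph g : x y / x + y} -> (forall k, {morph g : x / k *: x}) ->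
  (forall a, f (to_ext a) = g (to_ext a)) -> f =1 g.
Proof.
move=> fD fZ gD gZ fg u.
have f0 : f 0 = 0 by have := fZ 0 0; rewrite !scale0r.
have g0 : g 0 = 0 by have := gZ 0 0; rewrite !scale0r.
rewrite (ext_basis u) (big_morph f fD f0) (big_morph g gD g0).
by apply: eq_bigr => i _; rewrite fZ gZ fg.
Qed.

Lemma ext_mulA : associative ext_mul.
Proof.
move=> u v w; move: u.
apply: (@eq_ext_linear (ext_mul^~ (ext_mul v w))
  (fun u => ext_mul (ext_mul u v) w)) => [x y|k x|x y|k x|a].
- by rewrite ext_mulDl.
- by rewrite ext_mulZl.
- by rewrite !ext_mulDl.
- by rewrite !ext_mulZl.
move: v; apply: (@eq_ext_linear (fun v => ext_mul (to_ext a) (ext_mul v w))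
  (fun v => ext_mul (ext_mul (to_ext a) v) w)) => [x y|k x|x y|k x|a'].
- by rewrite ext_mulDl ext_mulDr.
- by rewrite ext_mulZr ext_mulZl.
- by rewrite ext_mulDr ext_mulDl.
- by rewrite ext_mulZl ext_mulZr.
move: w; apply: (@eq_ext_linear
  (fun w => ext_mul (to_ext a) (ext_mul (to_ext a') w))
  (ext_mul (ext_mul (to_ext a) (to_ext a')))) => [x y|k x|x y|k x|a''].
- by rewrite !ext_mulDr.
- by rewrite !ext_mulZr.
- by rewrite ext_mulDr.
- by rewrite ext_mulZr.
by rewrite -!to_extM mulrA.
Qed.

Lemma ext_mul1l : left_id ext_one ext_mul.
Proof.
apply: (@eq_ext_linear (ext_mul ext_one) id) => // [x y|k x|a]; first by rewrite ext_mulDr.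
  by rewrite ext_mulZr.
by rewrite -to_extM mul1r.
Qed.

Lemma ext_mul1r : right_id ext_one ext_mul.
Proof.
apply: (@eq_ext_linear (ext_mul^~ ext_one) id) => // [x y|k x|a].
- by rewrite ext_mulDl.
- by rewrite ext_mulZl.
by rewrite -to_extM mulr1.
Qed.

Lemma ext_one_neq0 : ext_one != 0.
Proof. by rewrite -to_ext0 (inj_eq to_ext_inj) oner_eq0. Qed.

HB.instance Definition _ := GRing.Zmodule_isNzRing.Build AK
  ext_mulA ext_mul1l ext_mul1r ext_mulDl ext_mulDr ext_one_neq0.

HB.instance Definition _ := GRing.Lmodule_isLalgebra.Build K AK ext_mulZl.

HB.instance Definition _ := GRing.Lalgebra_isAlgebra.Build K AK ext_mulZr.

HB.instance Definition _ := Algebra_isFalgebra.Build K AK.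

End ScalarExt.

Definition is_minpoly (K : fieldType) (B : falgType K) (g : B)
    (p : {poly K}) : Prop :=
  [/\ p \is monic, horner_alg g p = 0 &
      forall q : {poly K},
        q \is monic -> horner_alg g q = 0 -> (size p <= size q)%N].

Section CharPoly.

Context (F : fieldType) (A : falgType F) (m : nat) (e : m.-tuple A).

Local Notation R := {mpoly F[m]}.
Local Notation K := {fraction R}.

Definition const_frac : {rmorphism F -> K} := @tofrac R \o @mpolyC m F.

Definition generic_elt : scalar_ext const_frac A :=
  \sum_(i < m) tofrac ('X_i : R) *: to_ext const_frac e`_i.

(* The minimal polynomial of the generic element over K has its coefficients  *)
(* in R; this is the (unique) polynomial over R that maps to it.              *)
Definition generic_minpoly : {poly R} :=
  epsilon (inhabits 0)
    (fun P : {poly R} => is_minpoly generic_elt (map_poly (@tofrac R) P)).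

Definition generic_deg : nat := (size generic_minpoly).-1.

Definition ch_poly (a : A) : {poly F} :=
  map_poly (meval (fun i : 'I_m => coord e i a)) generic_minpoly.

(* c_i(a), where                                                              *)
(* ch_poly a = 'X^n - c_1(a) 'X^(n-1) + ... + (-1)^n c_n(a), n = generic_deg. *)
Definition ch_coef (i : nat) (a : A) : F :=
  (-1) ^+ i * (ch_poly a)`_(generic_deg - i).

Definition alg_det (a : A) : F := ch_coef generic_deg a.

End CharPoly.

(* Main.v *)
From HB Require Import structures.
From Stdlib Require Import Classical ClassicalEpsilon.
Require Import Defs.
From mathcomp Require Import all_boot all_order all_algebra all_field.
From mathcomp.multinomials Require Import mpoly.

(* The ring R = F[t_1, ..., t_m] is factorial, so by Gauss' lemma the minimal *)
(* polynomial P of the generic element has coefficients in R and divides, in  *)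
(* R[x], the characteristic polynomial of right multiplication by the generic *)
(* element.  Hence det_A divides the regular norm, which is multiplicative.   *)
(* On the lines 1 + s x and 1 + t y this says that the polynomial             *)
(* det_A((1 + s x)(1 + t y)) divides N(s) M(t) in F[s, t] with N, M <> 0; by  *)
(* unique factorization it is then a product f(s) g(t).  Evaluating s and t   *)
(* at 0 and 1, and using det_A(1) = 1, gives the multiplicativity.  Working   *)
(* with indeterminates s and t makes this valid over finite fields as well.   *)

Set Implicit Arguments.
Unset Strict Implicit.
Unset Printing Implicit Defensive.

Import GRing.Theory.
Local Open Scope ring_scope.

(** * Factorial domains *)

(** Up to sign, the determinant is the constant term of the generic minimal polynomial P; it is tied
    to a multiplicative function by divisibility. [generic_Cayley_Hamilton] and Gauss's lemma
    ([factorial_mpoly], [monic_factor_integral]) put P in R[x], and [generic_minpoly_dvd] makes it a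
    factor of the regular characteristic polynomial. In [alg_det_lines], constant terms then give a
    factor of N(s) M(t), which [factor_separates_variables] splits as f(s) g(t). For h(s,t) of this
    form, h(0,0) h(s,t) = h(s,0) h(0,t) is immediate. [alg_detM] takes s = t = 1 on the lines from 1
    to the two elements, and [alg_det1] removes h(0,0). *)

Definition divides (D : comNzRingType) (a b : D) := exists c, b = c * a.

Section Factorial.
Variable D : idomainType.
Implicit Types a b c d p u : D.

Lemma divides_trans a b c : divides a b -> divides b c -> divides a c.
Proof. by move=> [x ->] [y ->]; exists (y * x); rewrite mulrA. Qed.

Lemma divides_mull a b : divides a (b * a).
Proof. by exists b. Qed.

Lemma divides_unit a u : u \is a GRing.unit -> divides a u ->
  a \is a GRing.unit.
Proof. by move=> Uu [c uE]; move: Uu; rewrite uE unitrM => /andP[]. Qed.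

Definition prime_elt p :=
  [/\ p != 0, p \isn't a GRing.unit &
      forall a b, divides p (a * b) -> divides p a \/ divides p b].

(** Prime rather than irreducible factors carry uniqueness with them, so existence alone defines
    factoriality and proofs can go by induction on the factors. *)
Inductive prime_fact : D -> Prop :=
| prime_fact_unit u : u \is a GRing.unit -> prime_fact u
| prime_fact_cons p d : prime_elt p -> prime_fact d -> prime_fact (p * d).

Lemma prime_factM a b : prime_fact a -> prime_fact b -> prime_fact (a * b).
Proof.
move=> + fb; elim=> [u Uu|p d pp _ IH]; last first.
  by rewrite -mulrA; apply: prime_fact_cons.
elim: fb => [v Uv|p d pp _ IH].
  by apply: prime_fact_unit; rewrite unitrM Uu.
by rewrite mulrCA; apply: prime_fact_cons.
Qed.

Lemma prime_fact1 p : prime_elt p -> prime_fact p.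
Proof.
by move=> pp; rewrite -[p]mulr1; apply: prime_fact_cons => //;
  apply: prime_fact_unit; rewrite unitr1.
Qed.

End Factorial.

Definition factorial_domain (D : idomainType) :=
  forall d : D, d != 0 -> prime_fact d.

Lemma factorial_field (F : fieldType) : factorial_domain F.
Proof. by move=> d d0; apply: prime_fact_unit; rewrite unitfE. Qed.

Lemma factorial_domain_iso (D E : idomainType) (f : {rmorphism D -> E})
    (g : E -> D) :
  cancel f g -> cancel g f -> factorial_domain D -> factorial_domain E.
Proof.
move=> fK gK facD.
have gM : {morph g : x y / x * y}.
  by move=> x y; apply: (can_inj fK); rewrite rmorphM !gK.
have fU x : (f x \is a GRing.unit) -> x \is a GRing.unit.
  move=> Ux; apply/unitrP; exists (g (f x)^-1).
  by split; apply: (can_inj fK); rewrite rmorphM gK rmorph1 ?mulVr ?mulrV.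
have fdiv x y : divides (f x) y <-> divides x (g y).
  split=> [[c ->]|[c gy]]; first by exists (g c); rewrite gM fK.
  by exists (f c); rewrite -rmorphM -gy gK.
have fprime p : prime_elt p -> prime_elt (f p).
  case=> p0 pU pP; split=> [||a b].
  - by rewrite -(rmorph0 f) (inj_eq (can_inj fK)).
  - by apply: contra pU => /fU.
  by move/fdiv; rewrite gM => /pP[]/fdiv; [left|right].
move=> d d0; rewrite -(gK d).
have: prime_fact (g d).
  by apply: facD; apply: contra_neq d0 => gd0; rewrite -(gK d) gd0 rmorph0.
elim=> [u Uu|p x /fprime pp _ IH].
  by apply: prime_fact_unit; rewrite rmorph_unit.
by rewrite rmorphM; apply: prime_fact_cons.
Qed.

(** * Gauss's lemma and factoriality of D[x] *)

Section FactorialPoly.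
Variable D : idomainType.
Implicit Types (p c d : D) (f g h q : {poly D}).

(* Leading terms are split off one at a time: p divides the product of the    *)
(* leading coefficients, hence one of them.                                   *)
Lemma prime_eltC p : prime_elt p -> prime_elt p%:P.
Proof.
case=> p0 pU pP; split=> [||a b]; first by rewrite polyC_eq0.
  apply: contra pU; rewrite poly_unitE coefC eqxx => /andP[] //.
have [k] := ubnP (size a + size b); elim: k a b => // k IH a b sab pab.
have [->|a0] := eqVneq a 0; first by left; exists 0; rewrite mul0r.
have [->|b0] := eqVneq b 0; first by right; exists 0; rewrite mul0r.
have reduce (x y : {poly D}) : x != 0 -> y != 0 -> divides p (lead_coef x) ->
    divides p%:P (x * y) ->
    exists x' : {poly D}, [/\ (size x' < size x)%N, divides p%:P (x' * y) &
                   divides p%:P x' -> divides p%:P x].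
  move=> x0 y0 [c xE] [r rE]; exists (x - c *: 'X^((size x).-1) * p%:P).
  have leadE : c *: 'X^((size x).-1) * p%:P = lead_coef x *: 'X^((size x).-1).
    by rewrite mulrC mul_polyC scalerA mulrC xE.
  split.
  - rewrite leadE [X in (_ < X)%N](polySpred x0) ltnS; apply/leq_sizeP => j.
    rewrite coefB coefZ coefXn leq_eqVlt => /predU1P[<-|ltj].
      by rewrite eqxx mulr1 subrr.
    by rewrite nth_default ?gtn_eqF ?mulr0 ?subr0 // (polySpred x0).
  - exists (r - c *: 'X^((size x).-1) * y); rewrite !mulrBl rE; congr (_ - _).
    by rewrite mulrAC.
  by case=> s sE; exists (s + c *: 'X^((size x).-1)); rewrite mulrDl -sE subrK.
have [|pa|pb] := pP (lead_coef a) (lead_coef b).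
- case: pab => r rE; exists (lead_coef r).
  by rewrite -lead_coefM rE lead_coefM lead_coefC.
- have [a' [sa' pa'b aa']] := reduce _ _ a0 b0 pa pab.
  have sk : (size a' + size b < k)%N.
    by rewrite ltnS in sab; apply: leq_trans sab; rewrite ltn_add2r.
  by case: (IH a' b sk pa'b); [move/aa'; left | right].
- rewrite mulrC in pab.
  have [b' [sb' pb'a bb']] := reduce _ _ b0 a0 pb pab.
  have sk : (size a + size b' < k)%N.
    by rewrite ltnS in sab; apply: leq_trans sab; rewrite ltn_add2l.
  by rewrite mulrC in pb'a; case: (IH a b' sk pb'a); [left | move/bb'; right].
Qed.

Lemma prime_factC c : prime_fact c -> prime_fact c%:P.
Proof.
elim=> [u Uu|p d pp _ IH]; first by apply: prime_fact_unit; rewrite rmorph_unit.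
by rewrite polyCM; apply: prime_fact_cons => //; apply: prime_eltC.
Qed.

(** The content is a unit, phrased through primes so that no gcd of coefficients has to be
    formed. *)
Definition primitive g := forall p, prime_elt p -> ~ divides p%:P g.

Hypothesis facD : factorial_domain D.

Lemma primitive_part g : g != 0 ->
  exists c h, [/\ g = c%:P * h, c != 0 & primitive h].
Proof.
move=> g0; have := facD (d := lead_coef g); rewrite lead_coef_eq0 => /(_ g0).
have : forall c, divides c%:P g -> divides c (lead_coef g).
  by move=> c [r ->]; exists (lead_coef r); rewrite lead_coefM lead_coefC.
move: (lead_coef g) => d gd fd.
elim: fd g g0 gd => {d} [u Uu|p d pp _ IH] g g0 gd.
  exists 1, g; rewrite mul1r oner_neq0; split=> // q [_ /negP qU _] /gd qu.
  exact/qU/(divides_unit Uu).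
have [p0 pU pP] := pp.
case: (classic (divides p%:P g)) => [[h gE]|npg].
  have h0 : h != 0 by apply: contra_neq g0 => h0; rewrite gE h0 mul0r.
  case: (IH h h0) => [c [r hE]|c [k [hE c0 prk]]].
    have [|s sE] := gd (c * p); first by exists r; rewrite gE hE polyCM mulrA.
    by exists s; apply: (mulfI p0); rewrite sE [c * p]mulrC mulrCA.
  exists (c * p), k; rewrite mulf_neq0 //; split=> //.
  by rewrite gE hE [c * p]mulrC polyCM mulrC mulrA.
apply: IH => // c cg; have [k pdE] := gd _ cg.
case: (pP k c); first by exists d; rewrite -pdE mulrC.
  by case=> l kE; exists l; apply: (mulfI p0); rewrite pdE kE mulrCA mulrA.
move=> [l cE]; case: npg; apply: divides_trans cg; exists l%:P.
by rewrite cE polyCM.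
Qed.

(* The prime factors of c are cancelled one at a time. *)
Lemma primitive_cancel g c f q : primitive g -> c != 0 ->
  c%:P * f = q * g -> divides g f.
Proof.
move=> prg c0; have fc := facD c0.
elim: fc q c0 => {c} [u Uu|p c pp _ IH] q.
  move=> _ E; exists (u^-1%:P * q); rewrite -mulrA -E mulrA -polyCM.
  by rewrite mulVr // mul1r.
rewrite mulf_eq0 negb_or => /andP[p0 c0] E.
have [_ _ /(_ q g)[]] := prime_eltC pp.
- by exists (c%:P * f); rewrite -E polyCM -mulrA mulrC.
- case=> r qE; apply: (IH r c0); apply: (@mulfI _ p%:P); rewrite ?polyC_eq0 //.
  by rewrite mulrA -polyCM E qE mulrA [r * _]mulrC.
- by move/prg => /(_ pp).
Qed.

(** Over a domain, [%|] is divisibility up to a nonzero constant, as over the fraction field;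
    primitivity of g lets the constant cancel. *)
Lemma primitive_dvdp g f : primitive g -> g %| f -> divides g f.
Proof.
move=> prg /Pdiv.WeakIdomain.dvdpP[[c q] /= c0 E].
by apply: (primitive_cancel (c := c) (q := q)) => //; rewrite mul_polyC.
Qed.

Lemma divides_dvdp g f : divides g f -> g %| f.
Proof. by case=> c ->; apply: dvdp_mull. Qed.

(** [irreducible_poly] refers to [%|], hence to the fraction field, where Euclid's lemma holds;
    [primitive_dvdp] brings the divisibility back to D. *)
Lemma primitive_irreducible_prime g :
  primitive g -> irreducible_poly g -> prime_elt g.
Proof.
move=> prg irrg; split=> [||a b].
- exact: irredp_neq0 irrg.
- apply/negP; rewrite poly_unitE => /andP[/eqP sg _].
  by have := irrg.1; rewrite sg.
move/divides_dvdp => gab.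
have [cga|] := boolP (coprimep g a).
  by right; apply: primitive_dvdp => //; rewrite -(Gauss_dvdpr _ cga).
rewrite /coprimep => /irrg/(_ (dvdp_gcdl _ _)) /eqp_dvdl gE.
by left; apply: primitive_dvdp => //; rewrite -gE dvdp_gcdr.
Qed.

Lemma primitive_factor g q : primitive g -> q %| g -> g != 0 ->
  exists h r, [/\ g = r * h, size h = size q & primitive h].
Proof.
move=> prg qg g0; have q0 : q != 0 by apply: contraTneq qg => ->; rewrite dvd0p.
have [c [h [qE c0 prh]]] := primitive_part q0; exists h.
have [r gE] : divides h g.
  by apply: primitive_dvdp => //; apply: dvdp_trans qg; rewrite qE dvdp_mull.
by exists r; rewrite qE mul_polyC size_scale.
Qed.

(** Strong induction on the size: the content factors in D, and the primitive part is a unit, a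
    prime, or a product of two polynomials of smaller degree. *)
Lemma factorial_poly : factorial_domain {poly D}.
Proof.
move=> f; have [k] := ubnP (size f); elim: k f => // k IH f sf f0.
have [c [h [fE c0 prh]]] := primitive_part f0.
have h0 : h != 0 by apply: contra_neq f0 => h0; rewrite fE h0 mulr0.
have {}sf : (size h < k.+1)%N by move: sf; rewrite fE mul_polyC size_scale.
rewrite fE; apply: prime_factM; first exact/prime_factC/facD.
(* A primitive constant has no prime factor, so it is a unit. *)
have [sh|sh] := leqP (size h) 1.
  have := sh; rewrite (size1_polyC sh) => _; move: (h0) prh.
  rewrite [in h != 0](size1_polyC sh) polyC_eq0 => hc0.
  rewrite [in primitive h](size1_polyC sh).
  case: (facD hc0) => [u Uu _|p d pp _ prpd].
    by apply: prime_fact_unit; rewrite rmorph_unit.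
  by case: (prpd p pp); exists d%:P; rewrite -polyCM mulrC.
case: (classic (irreducible_poly h)) => [irrh|redh].
  exact/prime_fact1/primitive_irreducible_prime.
have [q [sq qh nqh]] : exists q, [/\ size q != 1%N, q %| h & ~~ (q %= h)].
  apply: NNPP => nex; apply: redh; split=> // q sq qh.
  by apply/negPn/negP => nqh; apply: nex; exists q.
have [d [r [hE sd prd]]] := primitive_factor prh qh h0.
move: (h0); rewrite hE mulf_eq0 negb_or => /andP[r0 d0].
have sd1 : (1 < size d)%N by rewrite ltn_neqAle size_poly_gt0 d0 andbT eq_sym sd.
have sr1 : (1 < size r)%N.
  rewrite ltnNge; apply: contra nqh => /size1_polyC rE.
  rewrite -(dvdp_size_eqp qh) -sd hE rE mul_polyC size_scale //.
  by apply: contra_neq r0 => r00; rewrite rE r00.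
have shE : (size h).+1 = (size r + size d)%N.
  by rewrite hE size_mul // prednK // addn_gt0 size_poly_gt0 r0.
rewrite ltnS in sf.
apply: prime_factM; apply: IH => //; apply: leq_trans sf; rewrite -ltnS shE.
  by rewrite -addn2 leq_add2l.
by rewrite -add2n leq_add2r.
Qed.

End FactorialPoly.

(** * Denominators and integrality of monic factors *)

Lemma tofrac_inj (D : idomainType) : injective (@tofrac D).
Proof. by move=> x y /eqP; rewrite tofrac_eq => /eqP. Qed.

Lemma fraction_denominator (D : idomainType) (x : {fraction D}) :
  exists d n, d != 0 /\ tofrac d * x = tofrac n.
Proof.
exists \d_(repr x), \n_(repr x); split; first exact: denom_ratioP.
rewrite -[x in LHS]reprK; unlock FracField.tofrac.
rewrite -[LHS]FracField.pi_mul; apply/eqmodP; rewrite /FracField.mulf /=.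
rewrite !numden_Ratio ?mul1r ?oner_neq0 ?denom_ratioP // reprK /FracField.equivf.
by rewrite !numden_Ratio ?oner_neq0 ?denom_ratioP // mulr1.
Qed.

Lemma clear_denominators (D : idomainType) (p : {poly {fraction D}}) :
  exists d (q : {poly D}), d != 0 /\ map_poly (@tofrac D) q = tofrac d *: p.
Proof.
elim/poly_ind: p => [|p c [d [q [d0 qE]]]].
  by exists 1, 0; rewrite oner_neq0 scaler0 rmorph0.
have [e [n [e0 nE]]] := fraction_denominator c.
exists (e * d), (e *: q * 'X + (d * n)%:P); rewrite mulf_neq0 //; split=> //.
rewrite rmorphD rmorphM /= map_polyX map_polyC map_polyZ /= qE !rmorphM /= -nE.
rewrite scalerDr scalerAl scalerA; congr (_ + _).
by rewrite -!mul_polyC -!polyCM mulrA [tofrac d * _]mulrC.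
Qed.

(** A primitive g proportional to p divides C in D[x] by Gauss's lemma. As C is monic, the leading
    coefficient of g is a unit, and normalizing g gives p. *)
Lemma monic_factor_integral (D : idomainType) (p : {poly {fraction D}})
    (C : {poly D}) :
  factorial_domain D -> p \is monic -> C \is monic ->
  p %| map_poly (@tofrac D) C -> exists P, map_poly (@tofrac D) P = p.
Proof.
have minj : injective (map_poly (@tofrac D)).
  by apply: map_inj_poly; [exact: tofrac_inj | rewrite rmorph0].
move=> facD mp mC /dvdpP[s CE].
have [d [q [d0 qE]]] := clear_denominators p.
have q0 : q != 0.
  apply: contraTneq mp => q0; move/eqP: qE; rewrite q0 rmorph0 eq_sym.
  rewrite scaler_eq0 tofrac_eq0 (negPf d0) /= => /eqP->.
  by rewrite monicE lead_coef0 eq_sym oner_eq0.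
have [c [g [gE c0 prg]]] := primitive_part facD q0.
have [e [r [e0 rE]]] := clear_denominators s.
have [t tE] : divides g C.
  (* Clearing the denominators of both factors gives (d e) C = (c r) g over D. *)
  apply: (primitive_cancel facD prg (c := d * e) (q := c%:P * r)).
    by rewrite mulf_neq0.
  rewrite mulrAC -gE; apply: minj; rewrite !rmorphM /= qE rE CE map_polyC /=.
  by rewrite map_polyC /= -!mul_polyC [RHS]mulrACA [s * p]mulrC.
have Ug : lead_coef g \is a GRing.unit.
  apply/unitrP; exists (lead_coef t).
  by rewrite -lead_coefM -tE (monicP mC) mulrC -lead_coefM -tE (monicP mC).
exists ((lead_coef g)^-1 *: g).
have cgE : tofrac c *: map_poly (@tofrac D) g = tofrac d *: p.
  by rewrite -qE gE rmorphM /= map_polyC mul_polyC.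
have dE : tofrac d = tofrac c * tofrac (lead_coef g).
  have := congr1 lead_coef cgE; rewrite !lead_coefZ (monicP mp) mulr1 => <-.
  by rewrite lead_coef_map_inj ?rmorph0 //; apply: tofrac_inj.
apply: (@scalerI _ _ (tofrac d)); first by rewrite tofrac_eq0.
rewrite -cgE map_polyZ scalerA dE -mulrA -rmorphM.
by rewrite divrr // rmorph1 mulr1.
Qed.

(** * Factoriality in several variables *)

Lemma mpoly_rmorph_ext (R : comNzRingType) (S : nzRingType) n
    (f g : {rmorphism {mpoly R[n]} -> S}) :
  (forall c, f c%:MP = g c%:MP) -> (forall i, f 'X_i = g 'X_i) -> f =1 g.
Proof.
move=> fgC fgX p; rewrite [p]mpolyE !rmorph_sum; apply: eq_bigr => m _.
rewrite -mul_mpolyC !rmorphM /= fgC; congr (_ * _).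
rewrite mpolyXE_id !rmorph_prod; apply: eq_bigr => i _ /=.
by rewrite !rmorphXn /= fgX.
Qed.

Lemma muniXmax (R : comNzRingType) n : muni ('X_ord_max : {mpoly R[n.+1]}) = 'X.
Proof.
rewrite /muni mmapX mmap1U; case: splitP => //= j /eqP jE.
by have := ltn_ord j; rewrite -(eqP jE) ltnn.
Qed.

Lemma muniXwiden (R : comNzRingType) n (i : 'I_n) :
  muni ('X_(widen_ord (leqnSn n) i) : {mpoly R[n.+1]}) = ('X_i)%:P.
Proof.
rewrite /muni mmapX mmap1U; case: splitP => [j jE|j /eqP jE].
  by congr ('X__)%:P; apply/val_inj; rewrite /= -jE.
by have := ltn_ord i; move: jE; rewrite /= ord1 addn0 => /eqP->; rewrite ltnn.
Qed.

(** [muni] splits off the last variable and identifies [{mpoly F[n.+1]}] with [{poly {mpoly F[n]}}],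
    so induction reduces to [factorial_poly]. *)
Lemma factorial_mpoly (F : fieldType) n : factorial_domain {mpoly F[n]}.
Proof.
elim: n => [|n IH].
  apply: (@factorial_domain_iso _ _ (@mpolyC 0 F) (mcoeff 0%MM));
    last exact: factorial_field.
    by move=> c; rewrite mcoeffC eqxx mulr1.
  move=> p; apply/mpolyP => m; rewrite mcoeffC.
  have -> : m = 0%MM by apply/mnmP; case.
  by rewrite eqxx mulr1.
have comm (c : {mpoly F[n]}) : GRing.comm 'X_ord_max (mwiden c) by exact: mulrC.
pose f : {rmorphism {poly {mpoly F[n]}} -> {mpoly F[n.+1]}} := horner_morph comm.
have wK : @muni n F \o @mwiden n F =1 polyC.
  apply: mpoly_rmorph_ext => [c|i] /=; first by rewrite mwidenC muniC.
  by rewrite /mwiden mmapX mmap1U muniXwiden.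
apply: (@factorial_domain_iso _ _ f (@muni n F)); last exact: factorial_poly.
  elim/poly_ind => [|p c IHp]; first by rewrite !rmorph0.
  rewrite [f _]rmorphD [f _]rmorphM muniD muniM IHp.
  by rewrite /f /= horner_morphX horner_morphC muniXmax [muni _]wK.
move=> p; apply: (mpoly_rmorph_ext (f := f \o @muni n F) (g := idfun)) => [c|i] /=.
  by rewrite muniC horner_morphC /= mwidenC.
case: (unliftP ord_max i) => [j|] ->; last by rewrite muniXmax horner_morphX.
have -> : lift ord_max j = widen_ord (leqnSn n) j.
  by apply: val_inj; rewrite /= /bump leqNgt ltn_ord.
by rewrite muniXwiden horner_morphC /= /mwiden mmapX mmap1U.
Qed.

(** * Factors of N(s) M(t) *)

(** The inner variable is s, the outer one t. Each prime factor of N stays prime in F[s][t], so it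
    divides h, where it contributes to f, or k, where it cancels. *)
Lemma factor_separates_variables (F : fieldType) (N M : {poly F}) (h k : {poly {poly F}}) :
  N != 0 -> M != 0 -> h * k = N%:P * map_poly polyC M ->
  exists f g : {poly F}, h = f%:P * map_poly polyC g.
Proof.
move=> N0 M0; have fN : prime_fact N.
  by apply: factorial_poly N0; apply: factorial_field.
elim: fN M M0 h k => {N0 N} [u Uu|p d pp _ IH] M M0 h k E; last first.
  have [_ _ /(_ h k)[]] := prime_eltC pp.
  - by rewrite E polyCM -mulrA mulrC; apply: divides_mull.
  - case=> h' hE.
    have p0 : p%:P != 0 :> {poly {poly F}} by case: pp; rewrite polyC_eq0.
    have [|f [g h'E]] := IH M M0 h' k.
      by apply: (mulIf p0); rewrite mulrAC -hE E polyCM -mulrA mulrC.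
    by exists (p * f), g; rewrite hE h'E polyCM mulrC mulrA.
  - case=> k' kE.
    have p0 : p%:P != 0 :> {poly {poly F}} by case: pp; rewrite polyC_eq0.
    apply: (IH M M0 h k'); apply: (mulIf p0).
    by rewrite -mulrA -kE E polyCM -mulrA mulrC.
(* N is now a constant. After swapping the variables the product has degree 0 in s, hence so does
   h. *)
have [c c0 uE] : exists2 c, c != 0 & u = c%:P.
  by move: Uu; rewrite poly_unitE => /andP[/size_poly1P[c c0 ->]]; exists c.
have := congr1 swapXY E; rewrite !rmorphM /= swapXY_map_polyC swapXY_polyC uE.
rewrite map_polyC /= -polyCM => sE.
have : (size (swapXY h * swapXY k)%R <= 1)%N by rewrite sE size_polyC leq_b1.
have cM0 : c%:P * M != 0 by rewrite mulf_neq0 // polyC_eq0.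
have : swapXY h * swapXY k != 0 by rewrite sE polyC_eq0.
rewrite mulf_eq0 negb_or => /andP[h0 k0].
rewrite size_mul // => shk.
have /size1_polyC hE : (size (swapXY h) <= 1)%N.
  apply: leq_trans shk; rewrite -ltnS prednK ?addn_gt0 ?size_poly_gt0 ?h0 //.
  by rewrite -addn1 leq_add2l size_poly_gt0.
exists 1, (swapXY h)`_0; rewrite mul1r -swapXY_polyC -hE.
by rewrite swapXYK.
Qed.

Lemma horner_separated (F : fieldType) (f g : {poly F}) (s t : F) :
  (f%:P * map_poly polyC g).[t%:P].[s] = f.[s] * g.[t].
Proof. by rewrite hornerM hornerC hornerM horner_map hornerC. Qed.

(** * The generic element and right multiplication *)

Section Minpoly.
Variables (K : fieldType) (B : falgType K) (g : B).
Implicit Types p q : {poly K}.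

Lemma minpoly_exists q :
  q \is monic -> horner_alg g q = 0 -> exists p, is_minpoly g p.
Proof.
have [k] := ubnP (size q); elim: k q => // k IH q sq mq gq.
case: (classic (is_minpoly g q)) => [|nq]; first by exists q.
have [r [mr gr srq]] : exists r, [/\ r \is monic, horner_alg g r = 0 &
    (size r < size q)%N].
  apply: NNPP => nex; apply: nq; split=> // r mr gr.
  by rewrite leqNgt; apply/negP => srq; apply: nex; exists r.
by apply: (IH r) => //; rewrite ltnS in sq; apply: leq_trans sq.
Qed.

Lemma minpoly_dvd p q : is_minpoly g p -> horner_alg g q = 0 -> p %| q.
Proof.
case=> mp gp minp gq; rewrite /dvdp; apply: contraT => r0.
have gr : horner_alg g (q %% p) = 0.
  have := gq; rewrite [X in horner_alg g X](divp_eq q p) rmorphD rmorphM /=.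
  by rewrite gp mulr0 add0r.
have lr0 : lead_coef (q %% p) != 0 by rewrite lead_coef_eq0.
have := minp ((lead_coef (q %% p))^-1 *: (q %% p)).
rewrite monicE lead_coefZ mulVf // eqxx => /(_ isT).
rewrite linearZ /= gr mulr0 => /(_ erefl).
by rewrite size_scale ?invr_eq0 // leqNgt ltn_modp monic_neq0.
Qed.

End Minpoly.

Section RightMul.
Variables (F : fieldType) (A : falgType F) (m' : nat).
Local Notation m := m'.+1.
Variables (e : m.-tuple A) (he : basis_of {:A} e).
Local Notation R := {mpoly F[m]}.
Local Notation K := {fraction R}.
Local Notation iota := (const_frac F m).

Lemma coord_basis_sum x : x = \sum_i coord e i x *: e`_i.
Proof. exact: coord_basis he (memvf x). Qed.

(* Matrices act on row vectors, so right multiplication is what makes this    *)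
(* multiplicative without reversing the order.                                *)
Definition rmul_mx (x : A) : 'M[F]_m := \matrix_(i, j) coord e j (e`_i * x).

Lemma rmul_mx_is_linear : linear rmul_mx.
Proof.
by move=> k x y; apply/matrixP => i j; rewrite !mxE mulrDr -scalerAr linearP.
Qed.
HB.instance Definition _ := GRing.isLinear.Build F A 'M[F]_m _ rmul_mx
  rmul_mx_is_linear.

Lemma rmul_mxM x y : rmul_mx (x * y) = rmul_mx x *m rmul_mx y.
Proof.
apply/matrixP => i j; rewrite !mxE mulrA {1}[e`_i * x]coord_basis_sum.
rewrite mulr_suml linear_sum; apply: eq_bigr => k _ /=.
by rewrite !mxE -scalerAl linearZ.
Qed.

Lemma rmul_mx1 : rmul_mx 1 = 1%:M.
Proof.
apply/matrixP => i j; rewrite !mxE mulr1 coord_free ?(basis_free he) //.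
Qed.

(** Right multiplication by the generic element, taken over R rather than K so that its
    characteristic polynomial is monic in R[x]. *)
Definition generic_mx : 'M[R]_m :=
  \sum_i 'X_i *: map_mx (@mpolyC m F) (rmul_mx e`_i).

Lemma map_generic_mx (S : comNzRingType) (f : {rmorphism R -> S}) :
  map_mx f generic_mx =
  \sum_i f 'X_i *: map_mx (f \o @mpolyC m F) (rmul_mx e`_i).
Proof.
rewrite /generic_mx map_mx_sum; apply: eq_bigr => i _.
by rewrite map_mxZ -map_mx_comp.
Qed.

(** Passes from coordinates in [e] to [scalar_ext], whose own coordinates refer to [vbasis]. *)
Definition of_row (r : 'rV[K]_m) : scalar_ext iota A :=
  \sum_i r 0 i *: to_ext iota e`_i.

Lemma of_row_is_linear : linear of_row.
Proof.
move=> k x y; rewrite /of_row scaler_sumr -big_split; apply: eq_bigr => i _ /=.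
by rewrite !mxE scalerDl scalerA.
Qed.
HB.instance Definition _ := GRing.isLinear.Build K _ _ _ of_row of_row_is_linear.

Lemma to_ext_basis x :
  to_ext iota x = \sum_i iota (coord e i x) *: to_ext iota e`_i.
Proof.
rewrite [in LHS](coord_basis_sum x) to_ext_sum.
by apply: eq_bigr => i _; rewrite to_extZ.
Qed.

Local Notation GK := (map_mx (@tofrac R) generic_mx).

Lemma of_rowM r : of_row r * generic_elt e = of_row (r *m GK).
Proof.
rewrite /of_row /generic_elt mulr_suml.
under eq_bigr => i _.
  rewrite mulr_sumr.
  under eq_bigr => j _.
    rewrite -scalerAl -scalerAr scalerA.
    have -> : to_ext iota e`_i * to_ext iota e`_j = to_ext iota (e`_i * e`_j).
      by rewrite to_extM.
    rewrite to_ext_basis scaler_sumr.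
    under eq_bigr => k _ do rewrite scalerA.
    over.
  rewrite exchange_big /=.
  over.
rewrite exchange_big /=; apply: eq_bigr => k _.
rewrite !mxE scaler_suml; apply: eq_bigr => i _.
rewrite map_generic_mx summxE mulr_sumr scaler_suml; apply: eq_bigr => j _.
by rewrite !mxE mulrA.
Qed.

(** Reduces evaluation at the generic element to evaluation at its matrix, where Cayley-Hamilton
    applies. *)
Lemma generic_horner p :
  horner_alg (generic_elt e) p =
  of_row (\row_i iota (coord e i 1) *m horner_mx GK p).
Proof.
elim/poly_ind: p => [|p c IH]; first by rewrite !rmorph0 mulmx0 linear0.
rewrite !rmorphD !rmorphM /= horner_algX horner_algC horner_mx_X horner_mx_C IH.
rewrite of_rowM mulmxDr mulmxA linearD /=; congr (_ + _).
rewrite mul_mx_scalar linearZ /=; congr (_ *: _).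
rewrite /of_row; have -> : 1 = to_ext iota 1 :> scalar_ext iota A by [].
by rewrite to_ext_basis; apply: eq_bigr => i _; rewrite mxE.
Qed.

Lemma generic_Cayley_Hamilton :
  horner_alg (generic_elt e) (map_poly (@tofrac R) (char_poly generic_mx)) = 0.
Proof.
by rewrite map_char_poly generic_horner Cayley_Hamilton mulmx0 linear0.
Qed.

(** Justifies the choice made by [epsilon]: the minimal polynomial over K divides a monic polynomial
    of R[x], and R is factorial. *)
Lemma generic_minpolyP :
  is_minpoly (generic_elt e) (map_poly (@tofrac R) (generic_minpoly e)).
Proof.
apply: (epsilon_spec (inhabits 0)
  (fun P => is_minpoly (generic_elt e) (map_poly (@tofrac R) P))).
have mC : char_poly generic_mx \is monic by exact: char_poly_monic.
have [p pmin] : exists p, is_minpoly (generic_elt e) p.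
  apply: (minpoly_exists _ generic_Cayley_Hamilton).
  by rewrite map_char_poly char_poly_monic.
have [P PE] : exists P, map_poly (@tofrac R) P = p.
  apply: (monic_factor_integral (C := char_poly generic_mx)) => //.
  - exact: factorial_mpoly.
  - by case: pmin.
  - exact: minpoly_dvd generic_Cayley_Hamilton.
by exists P; rewrite PE.
Qed.

Lemma generic_minpoly_monic : generic_minpoly e \is monic.
Proof.
have [mP _ _] := generic_minpolyP; move: mP.
rewrite !monicE lead_coef_map_inj ?rmorph0 //.
  by rewrite -(rmorph1 (@tofrac R)) tofrac_eq.
exact: tofrac_inj.
Qed.

(** Division by the monic P stays inside R[x]; over K, P divides the remainder, which has smaller
    degree and so vanishes. *)
Lemma generic_minpoly_dvd :
  exists q, char_poly generic_mx = q * generic_minpoly e.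
Proof.
have mP := generic_minpoly_monic.
set P := generic_minpoly e in mP *; set C := char_poly _.
have minj : injective (map_poly (@tofrac R)).
  by apply: map_inj_poly; [exact: tofrac_inj | rewrite rmorph0].
have CE := Pdiv.RingMonic.rdivp_eq mP C.
exists (Pdiv.CommonRing.rdivp C P); rewrite {1}CE.
set r := Pdiv.CommonRing.rmodp C P in CE *.
suff -> : r = 0 by rewrite addr0.
apply: minj; rewrite rmorph0; apply/eqP; apply: contraT => r0.
have : map_poly (@tofrac R) P %| map_poly (@tofrac R) r.
  have := minpoly_dvd generic_minpolyP generic_Cayley_Hamilton.
  by rewrite -/C CE rmorphD rmorphM /= dvdp_addr // dvdp_mull.
move=> /(dvdp_leq r0); rewrite !size_map_inj_poly ?rmorph0 //;
  try exact: tofrac_inj.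
by rewrite leqNgt Pdiv.CommonRing.ltn_rmodp monic_neq0.
Qed.

(** * Specialization to elements of A and multiplicativity along lines *)

Local Notation n := (generic_deg e).
Local Notation pt x := (fun i : 'I_m => coord e i x).

Lemma alg_detE x : alg_det e x = (-1) ^+ n * ((generic_minpoly e)`_0).@[pt x].
Proof. by rewrite /alg_det /ch_coef subnn /ch_poly coef_map. Qed.

Lemma map_generic_mx_pt x : map_mx (meval (pt x)) generic_mx = rmul_mx x.
Proof.
rewrite (map_generic_mx (meval (pt x))) [in RHS](coord_basis_sum x) linear_sum.
apply: eq_bigr => i _; rewrite linearZ /= mevalXU; congr (_ *: _).
by apply/matrixP => j k; rewrite !mxE /= mevalC.
Qed.

(** The characteristic polynomial of 1 is a monic divisor of (x - 1)^m, hence equals (x - 1)^n. *)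
Lemma alg_det1 : alg_det e 1 = 1.
Proof.
rewrite alg_detE -(coef_map (meval (pt 1))) -/(ch_poly e 1).
have [q qE] := generic_minpoly_dvd.
have mP := generic_minpoly_monic.
have mch : ch_poly e 1 \is monic by apply: monic_map.
have : ch_poly e 1 %| ('X - 1%:P) ^+ m.
  have := congr1 (map_poly (meval (pt 1))) qE.
  rewrite map_char_poly map_generic_mx_pt rmul_mx1 rmorphM /= => chE.
  have -> : ('X - 1%:P) ^+ m = char_poly (1%:M : 'M[F]_m).
    by rewrite /char_poly /char_poly_mx map_scalar_mx /= -raddfB det_scalar.
  by rewrite chE dvdp_mull.
move=> /dvdp_exp_XsubCP[k _].
rewrite eqp_monic ?monic_exp ?monicXsubC // => /eqP chE.
have kn : k = n.
  have := congr1 (size \o @polyseq F) chE; rewrite /= size_exp_XsubC.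
  rewrite /ch_poly size_map_poly_id0 ?(monicP mP) ?rmorph1 ?oner_neq0 //.
  by rewrite /generic_deg => ->.
rewrite chE -horner_coef0 horner_exp !hornerE kn -exprMn.
by rewrite mulrNN mul1r expr1n.
Qed.


(** The regular norm along the line through 1 in direction x; its value 1 at 0 makes it a nonzero
    polynomial. *)
Definition det_line (x : A) : {poly F} :=
  \det (1%:M + 'X *: map_mx polyC (rmul_mx x)).

Lemma det_line_neq0 x : det_line x != 0.
Proof.
apply/eqP => /(congr1 (horner_eval 0)); rewrite rmorph0 /det_line -det_map_mx.
rewrite map_mxD map_mxZ map_mx1 /= /horner_eval hornerX scale0r addr0 det1.
by move/eqP; rewrite oner_eq0.
Qed.

Lemma alg_det_lines x y (h := fun s t : F =>
    alg_det e ((1 + s *: x) * (1 + t *: y))) (s t : F) :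
  h 0 0 * h s t = h s 0 * h 0 t.
Proof.
pose S : comNzRingType := {poly {poly F}}.
pose c2 : {rmorphism F -> S} := @polyC {poly F} \o @polyC F.
pose X : S := 'X%:P; pose Y : S := 'X.
(* The coordinates of (1 + X x) (1 + Y y). *)
pose v i : S := c2 (coord e i 1) + X * c2 (coord e i x) + Y * c2 (coord e i y)
  + X * Y * c2 (coord e i (x * y)).
(* Specializes the generic element to (1 + X x)(1 + Y y), with X and Y still indeterminate. *)
pose ev : {rmorphism R -> S} := mmap c2 v.
have [q qE] := generic_minpoly_dvd.
have evG : map_mx ev generic_mx =
    (1%:M + X *: map_mx c2 (rmul_mx x)) *m (1%:M + Y *: map_mx c2 (rmul_mx y)).
  have -> : map_mx ev generic_mx = map_mx c2 (rmul_mx 1)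
      + X *: map_mx c2 (rmul_mx x) + Y *: map_mx c2 (rmul_mx y)
      + (X * Y) *: map_mx c2 (rmul_mx (x * y)).
    have mapE z : map_mx c2 (rmul_mx z) =
        \sum_i c2 (coord e i z) *: map_mx c2 (rmul_mx e`_i).
      rewrite {1}(coord_basis_sum z) linear_sum map_mx_sum.
      by apply: eq_bigr => i _; rewrite linearZ map_mxZ.
    rewrite (map_generic_mx ev) !mapE !scaler_sumr -!big_split.
    apply: eq_bigr => i _ /=; rewrite /ev /= mmapX mmap1U.
    rewrite (_ : map_mx _ _ = map_mx c2 (rmul_mx e`_i)); last first.
      by apply/matrixP => j k; rewrite !mxE /= mmapC.
    by rewrite !scalerA -!scalerDl.
  rewrite rmul_mx1 map_mx1 rmul_mxM map_mxM mulmxDl mul1mx mulmxDr mulmx1.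
  rewrite -scalemxAl -scalemxAr scalerA !addrA; congr (_ + _).
  by rewrite addrAC.
have [f [g fgE]] : exists f g : {poly F},
    ev (generic_minpoly e)`_0 = f%:P * map_poly polyC g.
  apply: (factor_separates_variables (det_line_neq0 x) (det_line_neq0 y)
    (k := (-1) ^+ m * ev q`_0)).
  (* The sign turns the constant term of the characteristic polynomial into the determinant of the
     generic matrix. *)
  have := congr1 (fun p : {poly R} => ev ((-1) ^+ m * p`_0)) qE.
  rewrite char_poly_det mulrA -exprMn mulrNN mul1r expr1n mul1r coef0M.
  rewrite -det_map_mx evG det_mulmx => detE.
  rewrite mulrCA [_ * ev q`_0]mulrC.
  have -> : (det_line x)%:P = \det (1%:M + X *: map_mx c2 (rmul_mx x)).
    rewrite /det_line -det_map_mx map_mxD map_mxZ map_mx1.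
    by rewrite -map_mx_comp.
  have -> : map_poly polyC (det_line y) = \det (1%:M + Y *: map_mx c2 (rmul_mx y)).
    rewrite /det_line -det_map_mx map_mxD map_mxZ map_mx1 -map_mx_comp /=.
    rewrite map_polyX.
    by congr (\det (_ + _ *: _)); apply/matrixP => i j; rewrite !mxE /= map_polyC.
  by rewrite detE !rmorphM rmorphXn rmorphN1.
have hE a b : h a b = (-1) ^+ n * (f.[a] * g.[b]).
  rewrite /h alg_detE -horner_separated -fgE; congr (_ * _).
  (* [phi] sets X to a and Y to b; after [ev] it agrees with evaluation at the coordinates of (1 + a
     x)(1 + b y), as a check on constants and variables shows. *)
  pose phi : {rmorphism S -> F} := horner_eval a \o horner_eval b%:P.
  rewrite -[RHS]/((phi \o ev) _).
  apply: (mpoly_rmorph_ext (f := meval _) (g := phi \o ev)) => [c|i] /=.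
    by rewrite mevalC mmapC /horner_eval /= !hornerC.
  rewrite mevalXU mmapX mmap1U /v /horner_eval /X /Y /c2 /= !hornerE.
  rewrite mulrDl mul1r mulrDr mulr1 -scalerAl -scalerAr !linearD !linearZ /=.
  by rewrite !addrA mulrA; congr (_ + _); rewrite addrAC.
rewrite !hE mulrACA [RHS]mulrACA; congr (_ * _).
by rewrite mulrACA [RHS]mulrACA [f.[0] * _]mulrC.
Qed.

Lemma alg_detM x y : alg_det e (x * y) = alg_det e x * alg_det e y.
Proof.
(* Both lines pass through 1 at parameter 0 and reach x and y at parameter 1. *)
have := alg_det_lines (x - 1) (y - 1) 1 1.
rewrite /= !scale0r !scale1r !addr0 ![1 + (_ - 1)]addrC !subrK.
by rewrite !(mulr1, mul1r) alg_det1 mul1r.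
Qed.

End RightMul.

Theorem theorem5p1 (F : fieldType) (A : falgType F)
    (m : nat) (e : m.-tuple A) (he : basis_of {:A} e) (a a' : A) :
  alg_det e (a * a') = alg_det e a * alg_det e a'.
Proof.
(* An empty basis would force 1 = 0 in A. *)
case: m e he => [|m] e he; last exact: alg_detM.
have := coord_basis he (memvf (1 : A)); rewrite big_ord0 => /eqP.
by rewrite oner_eq0.
Qed.
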